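(* In the setting of the context, suppose that the reinsurance premium is given by the expected value principle $$q(t,y,u)=(1+\theta_r)\mathbb E[Z]\lambda(t,y)u\qquad\forall(t,y,u)\in[0,T]\times\mathbb R\times[0,1]$$ for some constant $\theta_r>0$. Then for all $(t,y)\in[0,T]\times\mathbb R$ there exists a unique maximizer $u^*(t)$ (not depending on $y$) for the problem $\sup_{u\in[0,1]}\Psi^u(t,y)$. In particular, $$u^*(t)=\begin{cases}0&t\in A_0\\ \hat u(t)&t\in[0,T]\setminus A_0\end{cases}$$ where $$A_0=\bigl\{t\in[0,T]:\ \mathbb E[Ze^{\eta Ze^{R(T-t)}}]\le(1+\theta_r)\mathbb E[Z]\bigr\}$$ and $\hat u(t)$ is the unique solution to $$(1+\theta_r)\mathbb E[Z]=\int_0^Dze^{\eta(1-u)ze^{R(T-t)}}\,dF_Z(z).$$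
   Context: Fix $T>0$, $R>0$, $\eta>0$, $D\in(0,+\infty]$. $\lambda:[0,T]\times\mathbb R\to(0,+\infty)$ is measurable. $Z$ is a strictly positive random variable with distribution function $F_Z$, $F_Z(z)=1$ for $z\ge D$, and $\mathbb E[e^{\eta Ze^{RT}}]$, $\mathbb E[Ze^{\eta Ze^{RT}}]$, $\mathbb E[Z^2e^{\eta Ze^{RT}}]$ are finite. $\Psi^u(t,y)=-\eta e^{R(T-t)}q(t,y,u)+\lambda(t,y)\int_0^D[1-e^{\eta(1-u)ze^{R(T-t)}}]\,dF_Z(z)$. *)

(* Defs.v *)
From HB Require Import structures.
From mathcomp Require Import all_boot all_order all_algebra.
From mathcomp Require Import all_classical all_reals all_analysis.

Set Implicit Arguments.
Unset Strict Implicit.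
Unset Printing Implicit Defensive.

Import Order.TTheory GRing.Theory Num.Theory.
Import numFieldNormedType.Exports.

Local Open Scope classical_set_scope.
Local Open Scope ring_scope.

(* [cdf] takes values in \bar K, whereas [lebesgue_stieltjes_measure] expects a
   cumulative function K -> K; [fine] loses nothing, as 0 <= cdf <= 1. *)
Section distribution_function.
Context d (Omega : measurableType d) (K : realType) (P : probability Omega K).
Variable Z : {RV P >-> K}.

Definition distr_fun (z : K) : K := fine (cdf Z z).

Let distr_fun_nd : nondecreasing distr_fun.
Proof.
by move=> *; rewrite /distr_fun fine_le ?fin_num_measure// cdf_nondecreasing.
Qed.

Let distr_fun_rc : right_continuous distr_fun.
Proof.
move=> a; apply: fine_cvg.
by rewrite fineK ?fin_num_measure//; exact: cdf_right_continuous.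
Qed.

HB.instance Definition _ :=
  isCumulative.Build K _ K distr_fun distr_fun_nd distr_fun_rc.

Definition dF := lebesgue_stieltjes_measure distr_fun.

(* Hence dF is the law of Z. *)
Lemma dFE (A : set K) : measurable A -> dF A = distribution P Z A.
Proof.
pose Z' : Omega -> measurableTypeR K := Z.
have mZ' : measurable_fun setT Z'.
  exact: (@measurable_funPT _ _ _ _ Z).
pose W : {mfun Omega >-> measurableTypeR K} :=
  HB.pack Z' (isMeasurableFun.Build _ _ _ _ Z' mZ').
move=> mA.
apply: (@lebesgue_stieltjes_measure_unique _ _ (distribution P W))
  => [I [[a b]]/= _ <- | //].
change (lebesgue_stieltjes_measure distr_fun `]a, b] =
  distribution P Z `]a, b]).
rewrite /lebesgue_stieltjes_measure /measure_extension/=.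
rewrite measurable_mu_extE/=; last exact: is_ocitv.
have [ab | ba] := leP a b; last first.
  by rewrite set_itv_ge ?wlength0 ?measure0// bnd_simp -leNgt ltW.
rewrite wlength_itv_bnd// /distr_fun EFinB !fineK ?fin_num_measure// /cdf.
have -> : `]a, b]%classic = `]-oo, b] `\` `]-oo, a].
  by rewrite -[RHS]setCK setCD setCitvl setUC -[LHS]setCK setCitv.
rewrite [RHS]measureD ?setIidr//; first exact: subset_itvl.
by rewrite -ge0_fin_numE// fin_num_measure.
Qed.

End distribution_function.

(* Range of the integrals "from 0 to D"; D may be +oo. Whether the endpoint 0
   is included is immaterial for a strictly positive Z. *)
Definition upto (K : realType) (D : \bar K) : set K :=
  [set z : K | 0 < z /\ (z%:E <= D)%E].

Section reinsurance.
Context d (Omega : measurableType d) (K : realType) (P : probability Omega K).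
Variables (T R eta : K) (D : \bar K) (Z : {RV P >-> K}).

(* For 0 <= u <= 1 and 0 <= t <= T the integrand is dF-integrable as soon as
   E[exp(eta Z e^{RT})] is finite, so the real-valued integral is the genuine
   one there. *)
Definition Psi (lambda : K -> K -> K) (q : K -> K -> K -> K) (t y u : K) : K :=
  - eta * expR (R * (T - t)) * q t y u
  + lambda t y *
    \int[dF Z]_(z in upto D)
       (1 - expR (eta * (1 - u) * z * expR (R * (T - t)))).

Definition A0 (theta_r : K) : set K :=
  [set t | t \in `[0, T] /\
     ('E_P[(fun w => Z w * expR (eta * Z w * expR (R * (T - t))))%R]
        <= (1 + theta_r)%:E * 'E_P[Z])%E].

(* The integral is taken in \bar K: for u < 0 it may be infinite, in which case
   u does not solve the equation. *)
Definition solves_FOC (theta_r t u : K) : Prop :=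
  ((1 + theta_r)%:E * 'E_P[Z] =
   \int[dF Z]_(z in upto D)
      (z * expR (eta * (1 - u) * z * expR (R * (T - t))))%:E)%E.

End reinsurance.

Definition is_argmax_on (K : realType) (f : K -> K) (A : set K) (u : K) : Prop :=
  A u /\ forall v, A v -> f v <= f u.

(* Main.v *)
Require Import Defs.
From HB Require Import structures.
From mathcomp Require Import all_boot all_order all_algebra.
From mathcomp Require Import all_classical all_reals all_analysis.
From mathcomp Require Import measurable_realfun ring lra.

Set Implicit Arguments.
Unset Strict Implicit.
Unset Printing Implicit Defensive.

Import Order.TTheory GRing.Theory Num.Theory.
Import numFieldNormedType.Exports.

Local Open Scope classical_set_scope.
Local Open Scope ring_scope.

(* Put c = eta e^{R(T-t)}, s = c(1-u), k = (1+theta_r) E[Z] and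
   m_n(s) = E[Z^n e^{sZ}]. Up to the positive factor lambda and a constant,
   Psi is k s - m_0(s), the first-order condition reads m_1(s) = k, and t lies
   in A_0 iff m_1(c) <= k. No differentiation under the integral is needed:
   integrating the strict tangent inequality of exp gives
   m_0(s') > m_0(s) + (s' - s) m_1(s) for s' <> s, so s maximizes strictly as
   soon as (s' - s)(k - m_1(s)) <= 0 for all admissible s'. This covers both
   s = c (u = 0) on A_0 and the root of m_1(s) = k outside A_0. That root exists
   since m_1 is Lipschitz on [0, c] with constant m_2(c) and m_1(0) = E[Z] < k;
   it is unique since m_1 is strictly increasing where finite. *)

(** * Strict comparison of integrals and the tangent of the exponential *)

(** If the two integrals agreed, [g - f], positive on [U], would have integral zero and so vanish
    almost everywhere on [U], making [U] a null set. *)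
Lemma lt_Rintegral d (X : measurableType d) (K : realType)
    (mu : {measure set X -> \bar K}) (U : set X) (f g : X -> K) :
  measurable U -> mu U != 0%E ->
  mu.-integrable U (EFin \o f) -> mu.-integrable U (EFin \o g) ->
  (forall x, U x -> f x < g x) ->
  \int[mu]_(x in U) f x < \int[mu]_(x in U) g x.
Proof.
move=> mU muU intf intg fg; rewrite lt_neqAle; apply/andP; split; last first.
  by apply: le_Rintegral => // x /fg /ltW.
apply: contra muU => /eqP fgE.
have intB : mu.-integrable U (EFin \o (g \- f)).
  exact: (integrableB _ intg intf).
have B0 : (\int[mu]_(x in U) `|(g x - f x)%:E|)%E = 0%E.
  rewrite (eq_integral (fun x => (g x - f x)%:E)); last first.
    move=> x /set_mem Ux /=.
    by rewrite gtr0_norm// subr_gt0 fg.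
  rewrite -[LHS]fineK ?integrable_fin_num//; congr EFin.
  by have := RintegralB mU intg intf; rewrite fgE subrr.
have /(ae_eq_integral_abs _ mU) := B0.
move=> /(_ (measurable_int _ intB)) ae0.
apply/eqP/negligibleP => //; apply: negligibleS ae0 => x Ux /= /(_ Ux) /eqP.
by rewrite eqe subr_eq0 => /eqP gf; have := fg _ Ux; rewrite gf ltxx.
Qed.

(** Dividing by [expR x] leaves [1 + h < expR h] at the nonzero point [h = y - x]. *)
Lemma expR_gt_tangent (K : realType) (x y : K) : x != y ->
  expR x + (y - x) * expR x < expR y.
Proof.
move=> xy; have -> : expR y = expR x * expR (y - x).
  by rewrite -expRD addrC subrK.
rewrite -[X in X + _]mul1r -mulrDl [ltLHS]mulrC ltr_pM2l ?expR_gt0//.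
by rewrite expR_gt1Dx// subr_eq0 eq_sym.
Qed.

(** * Exponential moments of a positive function on a measure space *)

(** A divergent integral is sent to 0, so this is the true moment only where the integrand is
    integrable. *)
Definition exp_moment d (X : measurableType d) (K : realType)
    (mu : {measure set X -> \bar K}) (U : set X) (Z : X -> K)
    (n : nat) (s : K) :=
  \int[mu]_(x in U) (Z x ^+ n * expR (s * Z x)).

Section exponential_moments.
Context d (X : measurableType d) (K : realType).
Variables (mu : {measure set X -> \bar K}) (U : set X) (Z : X -> K) (c : K).
Hypotheses (mU : measurable U) (muU : mu U != 0%E).
Hypotheses (mZ : measurable_fun U Z) (Z_gt0 : forall x, U x -> 0 < Z x).

Local Notation moment := (exp_moment mu U Z).

Lemma integrable_exp_moment n s s' : s <= s' ->
  mu.-integrable U (fun x => (Z x ^+ n * expR (s' * Z x))%:E) ->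
  mu.-integrable U (fun x => (Z x ^+ n * expR (s * Z x))%:E).
Proof.
move=> ss'; apply: le_integrable => //.
  apply/measurable_EFinP/measurable_funM; first exact: measurable_funX.
  by apply: measurableT_comp => //; apply: measurable_funM.
move=> x Ux; rewrite lee_fin !normrM ler_wpM2l ?normr_ge0//.
by rewrite !ger0_norm ?expR_ge0// ler_expR ler_wpM2r// ltW// Z_gt0.
Qed.

Lemma exp_moment1_lt s s' : s < s' ->
  mu.-integrable U (fun x => (Z x ^+ 1 * expR (s' * Z x))%:E) ->
  moment 1 s < moment 1 s'.
Proof.
move=> ss' int1; apply: lt_Rintegral => //.
  exact: integrable_exp_moment (ltW ss') int1.
move=> x Ux; rewrite expr1 ltr_pM2l ?Z_gt0// ltr_expR.
by rewrite ltr_pM2r ?Z_gt0.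
Qed.

Lemma exp_moment1_gt0 s :
  mu.-integrable U (fun x => (Z x ^+ 1 * expR (s * Z x))%:E) ->
  0 < moment 1 s.
Proof.
move=> int1.
have -> : 0 = \int[mu]_(x in U) 0 :> K by rewrite /Rintegral integral0.
apply: lt_Rintegral => //; first exact: integrable0.
by move=> x Ux; rewrite expr1 mulr_gt0 ?Z_gt0// expR_gt0.
Qed.

Hypothesis moment_fin : forall n, (n <= 2)%N ->
  mu.-integrable U (fun x => (Z x ^+ n * expR (c * Z x))%:E).

Lemma exp_moment0_tangent s s' : s <= c -> s' <= c -> s != s' ->
  moment 0 s + (s' - s) * moment 1 s < moment 0 s'.
Proof.
move=> sc s'c ss'.
have int0 := integrable_exp_moment sc (moment_fin (isT : 0 <= 2)%N).
have int1 := integrable_exp_moment sc (moment_fin (isT : 1 <= 2)%N).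
have int1' := integrableZl mU (s' - s) int1.
rewrite -RintegralZl// -RintegralD//.
apply: lt_Rintegral => //.
- exact: (integrableD mU int0 int1').
- exact: integrable_exp_moment s'c (moment_fin _).
move=> x Ux; rewrite expr0 expr1 !mul1r mulrA mulrBl.
apply: expR_gt_tangent.
(* The tangent inequality is strict at every point because [Z x] is nonzero, so distinct [s] and
   [s'] give distinct exponents. *)
by apply: contra ss' => /eqP /mulIf -> //; rewrite gt_eqF// Z_gt0.
Qed.

(** The tangent at [s' * z] gives [expR (s' * z) - expR (s * z) <= (s' - s) * z * expR (s' * z)].
    Bounding the last exponent by [c * z], multiplying by [z] and integrating yields the second
    moment at [c]. *)
Lemma exp_moment1_lipschitz s s' : s <= s' -> s' <= c ->
  moment 1 s' - moment 1 s <= (s' - s) * moment 2 c.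
Proof.
move=> ss' s'c; have sc := le_trans ss' s'c.
have int2 := moment_fin (leqnn 2).
have int2' := integrableZl mU (s' - s) int2.
have int1 := integrable_exp_moment sc (moment_fin (isT : 1 <= 2)%N).
have int1' := integrable_exp_moment s'c (moment_fin (isT : 1 <= 2)%N).
rewrite -RintegralZl// -RintegralB//; apply: le_Rintegral => //.
  exact: (integrableB mU int1' int1).
move=> x Ux; have z0 := Z_gt0 Ux.
set z := Z x in z0 *.
have : expR (s' * z) <= expR (c * z) by rewrite ler_expR ler_pM2r.
have : expR (s' * z) + (s * z - s' * z) * expR (s' * z) <= expR (s * z).
  have [->|e] := eqVneq (s' * z) (s * z); first by rewrite subrr mul0r addr0.
  exact/ltW/expR_gt_tangent.
move=> h1 h2; rewrite expr1 expr2 -mulrBr.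
rewrite (_ : (s' - s) * _ = z * ((s' - s) * (z * expR (c * z)))); last by ring.
rewrite ler_pM2l//.
rewrite (@le_trans _ _ ((s' - s) * (z * expR (s' * z))))//; first lra.
by rewrite ler_wpM2l ?subr_ge0// ler_pM2l.
Qed.

Lemma continuous_exp_moment1 a : {within `[a, c], continuous (moment 1)}.
Proof.
have M2 : 0 <= moment 2 c.
  by apply: Rintegral_ge0 => x Ux; rewrite mulr_ge0 ?expR_ge0// sqr_ge0.
have lip s s' : s <= c -> s' <= c ->
    `|moment 1 s - moment 1 s'| <= `|s - s'| * moment 2 c.
  wlog ss' : s s' / s <= s' => [H sc s'c|sc s'c].
    by have [/H->//|/ltW/H] := leP s s'; rewrite distrC [`|s' - s|]distrC => ->.
  rewrite distrC [`|s - s'|]distrC (@ger0_norm _ (s' - s)) ?subr_ge0//.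
  rewrite ger0_norm ?exp_moment1_lipschitz// subr_ge0.
  move: ss'; rewrite le_eqVlt => /predU1P[->//|/exp_moment1_lt lt].
  by apply/ltW/lt; exact: integrable_exp_moment s'c (moment_fin _).
apply/subspace_continuousP => x; rewrite /= in_itv/= => /andP[_ xc].
apply/cvgrPdist_le => /= e e0; rewrite near_withinE/=.
(* Adding 1 keeps the denominator positive, since only [0 <= moment 2 c] has been established. *)
exists (e / (moment 2 c + 1)) => /=; first by rewrite divr_gt0// ltr_wpDl.
move=> y /= xy; rewrite in_itv/= => /andP[_ yc].
rewrite (le_trans (lip _ _ xc yc))//.
rewrite (@le_trans _ _ (e / (moment 2 c + 1) * moment 2 c))//.
  by rewrite ler_wpM2r// ltW.
by rewrite -mulrA ler_piMr ?ltW// mulrC ltr_pdivrMr ?mul1r ?ltrDl ?ltr_wpDl.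
Qed.

End exponential_moments.

(** * From [dF] and expectations to integrals over the event that [Z] lies in [upto D] *)

Section law_of_Z.
Context d (Omega : measurableType d) (K : realType) (P : probability Omega K).
Variables (D : \bar K) (Z : {RV P >-> K}).

Lemma measurable_upto : measurable (upto D : set K).
Proof.
case: D => [r| |].
- rewrite (_ : upto _ = [set` `]0, r]])//.
  by apply/seteqP; split => z; rewrite /upto /= in_itv/= lee_fin => /andP.
- rewrite (_ : upto _ = [set` `]0, +oo[])//.
  apply/seteqP; split => z; rewrite /upto /= in_itv/= andbT; first by case.
  by move=> ->; rewrite leey.
- rewrite (_ : upto _ = set0)//.
  by apply/seteqP; split => z //; rewrite /upto /= => -[].
Qed.

Lemma measurable_preimage_upto : measurable (Z @^-1` upto D).
Proof.
rewrite -[X in measurable X]setTI; apply: measurable_funPT => //.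
exact: measurable_upto.
Qed.

(** Change of variables, kept to nonnegative [f] with values in the extended reals so that it still
    applies when the integral is infinite, as may happen in [solves_FOC] for [u < 0]. *)
Lemma integral_dF (f : K -> \bar K) : measurable_fun setT f ->
  (forall z, 0 < z -> (0 <= f z)%E) ->
  (\int[dF Z]_(z in upto D) f z = \int[P]_(w in Z @^-1` upto D) f (Z w))%E.
Proof.
move=> mf f0.
(* dF lives on measurableTypeR K, whose display differs from the one of K in the
   type of Z, so Z is retyped and the law of Z is spelled as a pushforward. *)
pose Z' : Omega -> measurableTypeR K := Z.
have mZ' : measurable_fun setT Z' by exact: (@measurable_funPT _ _ _ _ Z).
have mU : measurable (upto D : set (measurableTypeR K)).
  exact: measurable_upto.
have mf' : measurable_fun (setT : set (measurableTypeR K)) f by exact: mf.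
rewrite (eq_measure_integral (pushforward P Z')); last first.
  by move=> A mA _; exact: dFE.
rewrite (ge0_integral_pushforward mZ')//; first exact: measurable_funTS.
by move=> z /set_mem[/f0].
Qed.

Hypotheses (D_gt0 : (0 < D)%E) (Z_gt0 : {ae P, forall w, 0 < Z w}).
Hypothesis F_Z1 : forall z : K, (D <= z%:E)%E -> cdf Z z = 1%E.

(** For finite [D], the value 1 of the distribution function at [D] makes the event [Z > D] null;
    for [D = +oo] the upper bound is trivial. *)
Lemma ae_upto : {ae P, forall w, upto D (Z w)}.
Proof.
have ZD : {ae P, forall w, ((Z w)%:E <= D)%E}.
  case: D D_gt0 F_Z1 => [r| |]// _ F1; last by apply: aeW => w; rewrite leey.
  have := F1 r (lexx _); rewrite /cdf /distribution/= /pushforward => PZr.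
  have mZr : measurable (Z @^-1` `]-oo, r]).
    by rewrite -[X in measurable X]setTI; exact: measurable_funPT.
  have : P (~` (Z @^-1` `]-oo, r])) = 0%E.
    by rewrite probability_setC// PZr subee.
  move=> /negligibleP; move=> /(_ (measurableC mZr)).
  by apply: negligibleS => w /= h; apply: contra_not h; rewrite lee_fin in_itv.
by apply: filterS2 Z_gt0 ZD.
Qed.

Lemma expectation_upto (f : K -> K) : measurable_fun setT f ->
  ('E_P[f \o Z] = \int[P]_(w in Z @^-1` upto D) (f (Z w))%:E)%E.
Proof.
move=> mf; have mU := measurable_preimage_upto.
have mfZ : measurable_fun setT (fun w => (f (Z w))%:E).
  by apply/measurable_EFinP; exact: measurableT_comp.
rewrite unlock [RHS]integral_mkcond; apply: ae_eq_integral => //.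
- by apply/(measurable_restrictT _ mU); exact: measurable_funTS.
by apply: filterS ae_upto => w Uw _; rewrite patchE mem_set.
Qed.

Lemma expectation_exp_moment n s (g : Omega -> K) :
  (forall w, g w = Z w ^+ n * expR (s * Z w)) ->
  ('E_P[g] = \int[P]_(w in Z @^-1` upto D) (Z w ^+ n * expR (s * Z w))%:E)%E.
Proof.
move=> /funext ->.
rewrite (@expectation_upto (fun z => z ^+ n * expR (s * z)))//.
apply: measurable_funM => //.
by apply: measurableT_comp => //; apply: measurable_funM.
Qed.

(** On this event [Z] is positive, so the integrand equals its absolute value. *)
Lemma integrable_exp_moment_fin_num n s :
  (\int[P]_(w in Z @^-1` upto D) (Z w ^+ n * expR (s * Z w))%:E)%E
    \is a fin_num ->
  P.-integrable (Z @^-1` upto D) (fun w => (Z w ^+ n * expR (s * Z w))%:E).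
Proof.
move=> fin; apply/integrableP; split.
  apply/measurable_EFinP/measurable_funTS/measurable_funM.
    exact: measurable_funX.
  by apply: measurableT_comp => //; apply: measurable_funM.
rewrite (eq_integral (fun w => (Z w ^+ n * expR (s * Z w))%:E)) ?ltey_eq ?fin//.
move=> w /set_mem[z0 _]/=.
by rewrite ger0_norm// mulr_ge0 ?expR_ge0// exprn_ge0// ltW.
Qed.

Lemma preimage_upto_neq0 : P (Z @^-1` upto D) != 0%E.
Proof.
apply/eqP => P0; have mU := measurable_preimage_upto.
have : P (~` (Z @^-1` upto D)) = 0%E.
  by apply/negligibleP; [exact: measurableC|exact: ae_upto].
by rewrite probability_setC// P0 sube0 => /eqP; rewrite onee_eq0.
Qed.

End law_of_Z.

(** Intermediate value theorem for the continuous first moment. *)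
Lemma exp_moment1_solve d (X : measurableType d) (K : realType)
    (mu : {measure set X -> \bar K}) (U : set X) (Z : X -> K) (c k : K) :
  measurable U -> mu U != 0%E -> measurable_fun U Z ->
  (forall x, U x -> 0 < Z x) ->
  (forall n, (n <= 2)%N ->
    mu.-integrable U (fun x => (Z x ^+ n * expR (c * Z x))%:E)) ->
  0 <= c -> exp_moment mu U Z 1 0 <= k <= exp_moment mu U Z 1 c ->
  exists2 s, 0 <= s <= c & exp_moment mu U Z 1 s = k.
Proof.
move=> mU muU mZ Z0 fin c0 /andP[k0 kc].
have [||s] := @IVT K (exp_moment mu U Z 1) 0 c k c0.
- exact: continuous_exp_moment1.
- by rewrite ge_min le_max k0 kc orbT.
by rewrite in_itv/=; exists s.
Qed.

(** * First-order condition and objective in terms of moments *)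

Section objective.
Context d (Omega : measurableType d) (K : realType) (P : probability Omega K).
Variables (T R eta : K) (D : \bar K) (Z : {RV P >-> K}).

Local Notation U := (Z @^-1` upto D).
Local Notation moment := (exp_moment P U Z).

Lemma solves_FOCE theta_r t u k : ((1 + theta_r)%:E * 'E_P[Z] = k%:E)%E ->
  solves_FOC T R eta D Z theta_r t u <->
  (\int[P]_(w in U) (Z w ^+ 1 *
     expR (eta * expR (R * (T - t)) * (1 - u) * Z w))%:E = k%:E)%E.
Proof.
move=> kE; rewrite /solves_FOC kE integral_dF.
- rewrite (eq_integral (fun w => (Z w ^+ 1 *
    expR (eta * expR (R * (T - t)) * (1 - u) * Z w))%:E)); first by split=> ->.
  by move=> w _; rewrite expr1; do 3 f_equal; ring.
- apply/measurable_EFinP; apply: measurable_funM => //.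
  by apply: measurableT_comp => //; do 2 apply: measurable_funM => //.
- by move=> z z0; rewrite lee_fin mulr_ge0 ?expR_ge0// ltW.
Qed.

Lemma PsiE lambda q t y u : 0 <= eta -> u \in `[0, 1] ->
  (forall n, (n <= 2)%N -> P.-integrable U
     (fun w => (Z w ^+ n * expR (eta * expR (R * (T - t)) * Z w))%:E)) ->
  Psi T R eta D Z lambda q t y u =
  - (eta * expR (R * (T - t))) * q t y u +
  lambda t y * (moment 0 0 - moment 0 (eta * expR (R * (T - t)) * (1 - u))).
Proof.
rewrite in_itv/= => eta0 /andP[u0 u1] fin.
rewrite /Psi !mulNr; congr (_ + _ * _).
set c := eta * expR (R * (T - t)) in fin *.
have c0 : 0 <= c by rewrite mulr_ge0// expR_ge0.
have s0 : 0 <= c * (1 - u) by rewrite mulr_ge0// subr_ge0.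
have sc : c * (1 - u) <= c by rewrite ler_piMr// gerBl.
have mU := @measurable_preimage_upto _ _ _ _ D Z.
have mZ : measurable_fun U Z by exact: measurable_funTS.
have Z0 w : U w -> 0 < Z w by case.
have int s : s <= c ->
    P.-integrable U (fun w => (Z w ^+ 0 * expR (s * Z w))%:E).
  by move=> /(integrable_exp_moment mU mZ Z0); apply; exact: fin.
rewrite -[RHS]opprB -(RintegralB mU (int _ sc) (int _ c0)).
rewrite /Rintegral -fineN; congr fine.
(* The integrand of [Psi] is [- f]. Since [u <= 1], [f] is nonnegative on positive [z], so the
   nonnegative change of variables applies after pulling out the sign. *)
pose f z := (expR (c * (1 - u) * z) - 1)%:E.
have f0 z : 0 < z -> (0 <= f z)%E.
  move=> z0; rewrite lee_fin subr_ge0 -[X in X <= _]expR0 ler_expR.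
  by rewrite mulr_ge0// ltW.
rewrite (eq_integral (fun z : measurableTypeR K => - f z)%E); last first.
  by move=> z _; rewrite -EFinN opprB; congr (1 - expR _)%:E; rewrite /c; ring.
rewrite integral_ge0N; last by move=> z [/f0].
rewrite integral_dF//; last first.
  apply/measurable_EFinP/measurable_funB => //.
  by apply: measurableT_comp => //; apply: measurable_funM.
congr (- _)%E; apply: eq_integral => w _.
by rewrite /f !expr0 !mul1r mul0r expR0.
Qed.

End objective.

(** * Existence, uniqueness and form of the maximizer *)

Theorem lemma4p2 (K : realType) (d : measure_display)
    (Omega : measurableType d) (P : probability Omega K)
    (T R eta : K) (D : \bar K)
    (hT : 0 < T) (hR : 0 < R) (heta : 0 < eta) (hD : (0 < D)%E)
    (lambda : K -> K -> K)
    (lambda_meas : measurable_fun (`[0, T] `*` [set: K])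
       (fun ty : K * K => lambda ty.1 ty.2))
    (lambda_gt0 : forall t y, t \in `[0, T] -> 0 < lambda t y)
    (Z : {RV P >-> K})
    (Z_gt0 : {ae P, forall w, 0 < Z w})
    (F_Z1 : forall z : K, (D <= z%:E)%E -> cdf Z z = 1%E)
    (Z_exp0 : 'E_P[(fun w => expR (eta * Z w * expR (R * T)))%R]%E \is a fin_num)
    (Z_exp1 : 'E_P[(fun w => Z w * expR (eta * Z w * expR (R * T)))%R]%E
                \is a fin_num)
    (Z_exp2 : 'E_P[(fun w => Z w ^+ 2 * expR (eta * Z w * expR (R * T)))%R]%E
                \is a fin_num)
    (theta_r : K) (htheta : 0 < theta_r)
    (q : K -> K -> K -> K)
    (q_evp : forall t y u, t \in `[0, T] -> u \in `[0, 1] ->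
       q t y u = (1 + theta_r) * fine 'E_P[Z]%E * lambda t y * u) :
  exists ustar uhat : K -> K,
    (forall t y, t \in `[0, T] ->
       unique (is_argmax_on (Psi T R eta D Z lambda q t y) `[0, 1]) (ustar t)) /\
    (forall t, t \in `[0, T] -> ~ A0 T R eta Z theta_r t ->
       unique (solves_FOC T R eta D Z theta_r t) (uhat t)) /\
    (forall t, A0 T R eta Z theta_r t -> ustar t = 0) /\
    (forall t, t \in `[0, T] -> ~ A0 T R eta Z theta_r t ->
       ustar t = uhat t).
Proof.
set U := Z @^-1` upto D; pose moment := exp_moment P U Z.
pose c t := eta * expR (R * (T - t)); pose k := (1 + theta_r) * moment 1%N 0.
have mU : measurable U := @measurable_preimage_upto _ _ _ _ D Z.
have PU : P U != 0%E by exact: preimage_upto_neq0 hD Z_gt0 F_Z1.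
have mZ : measurable_fun U Z by exact: measurable_funTS.
have Z0 w : U w -> 0 < Z w by case.
have E_moment := expectation_exp_moment hD Z_gt0 F_Z1.
have fin0 n : (n <= 2)%N ->
    P.-integrable U (fun w => (Z w ^+ n * expR (eta * expR (R * T) * Z w))%:E).
  have expE w : eta * expR (R * T) * Z w = eta * Z w * expR (R * T) by ring.
  case: n => [|[|[|//]]] _; apply: integrable_exp_moment_fin_num.
  - rewrite -(E_moment _ _ (fun w => expR (eta * Z w * expR (R * T))))//.
    by move=> w; rewrite expE expr0 mul1r.
  - rewrite -(E_moment _ _ (fun w => Z w * expR (eta * Z w * expR (R * T))))//.
    by move=> w; rewrite expE.
  - rewrite -(E_moment _ _
      (fun w => Z w ^+ 2 * expR (eta * Z w * expR (R * T))))//.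
    by move=> w; rewrite expE.
have c_gt0 t : 0 < c t by rewrite mulr_gt0// expR_gt0.
(* The assumed moments are those at [t = 0], where the exponent [c t] is largest; they dominate all
   later times. *)
have fin t : t \in `[0, T] -> forall n, (n <= 2)%N ->
    P.-integrable U (fun w => (Z w ^+ n * expR (c t * Z w))%:E).
  rewrite in_itv/= => /andP[t0 _] n /fin0; apply: integrable_exp_moment => //.
  by rewrite ler_pM2l// ler_expR ler_pM2l// gerBl.
have int_moment t n s : t \in `[0, T] -> (n <= 2)%N -> s <= c t ->
    (\int[P]_(w in U) (Z w ^+ n * expR (s * Z w))%:E)%E = (moment n s)%:E.
  move=> tT n2 sc; rewrite [RHS]fineK// integrable_fin_num//.
  exact: integrable_exp_moment sc (fin t tT n n2).
have T0 : T \in `[0, T] by rewrite in_itv/= lexx ltW.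
have EZ : 'E_P[Z]%E = (moment 1%N 0)%:E.
  rewrite (E_moment 1%N 0) ?(int_moment T)// ?ltW//.
  by move=> w; rewrite mul0r expR0 mulr1.
have kE : ((1 + theta_r)%:E * 'E_P[Z] = k%:E)%E by rewrite EZ.
have k_gt : moment 1%N 0 < k.
  rewrite ltr_pMl ?ltrDl//; apply: exp_moment1_gt0 => //.
  exact: integrable_exp_moment (ltW (c_gt0 T)) (fin T T0 1%N isT).
have A0E t : t \in `[0, T] ->
    (A0 T R eta Z theta_r t <-> moment 1%N (c t) <= k).
  move=> tT; rewrite /A0 /= kE (E_moment 1%N (c t)); last first.
    by move=> w; rewrite /c expr1; do 2 f_equal; ring.
  by rewrite (int_moment t)// lee_fin; split=> [[]//|].
have FOCE t u : solves_FOC T R eta D Z theta_r t u <->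
    (\int[P]_(w in U) (Z w ^+ 1 * expR (c t * (1 - u) * Z w))%:E = k%:E)%E.
  exact: solves_FOCE.
(* Uniqueness holds among all real [u]: being a solution forces the integral to equal the finite
   [k], which supplies the integrability needed for strict monotonicity. *)
have FOC_unique t u v : solves_FOC T R eta D Z theta_r t u ->
    solves_FOC T R eta D Z theta_r t v -> u = v.
  have lt_False u' v' : u' < v' -> solves_FOC T R eta D Z theta_r t u' ->
      solves_FOC T R eta D Z theta_r t v' -> False.
    move=> uv /FOCE uk /FOCE vk.
    have : moment 1%N (c t * (1 - v')) < moment 1%N (c t * (1 - u')).
      apply: exp_moment1_lt => //; first by rewrite ltr_pM2l// ltrD2l ltrN2.
      by apply: integrable_exp_moment_fin_num; rewrite uk.
    by rewrite /moment /exp_moment /Rintegral uk vk ltxx.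
  by move=> uk vk; have [/lt_False[]|/lt_False[]|] := ltgtP u v.
have FOC_exists t : t \in `[0, T] -> ~ A0 T R eta Z theta_r t ->
    exists u, 0 <= u <= 1 /\ solves_FOC T R eta D Z theta_r t u.
  move=> tT /(contra_not (A0E t tT).2) /negP; rewrite -ltNge => kc.
  have kb : moment 1%N 0 <= k <= moment 1%N (c t) by rewrite !ltW.
  have [s /andP[s0 sc] sk] :=
    exp_moment1_solve mU PU mZ Z0 (fin t tT) (ltW (c_gt0 t)) kb.
  (* Inverse of the substitution [s = c t * (1 - u)]; it maps [0 <= s <= c t] onto [0 <= u <= 1]. *)
  exists (1 - s / c t); split.
    by rewrite gerBl subr_ge0 ler_pdivrMr// mul1r sc divr_ge0// ltW.
  have cs : c t * (1 - (1 - s / c t)) = s by field; rewrite gt_eqF.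
  by apply/FOCE; rewrite cs (int_moment t)// /moment sk.
(* The bounds on [u] are stored with the equation so that the chosen root is admissible in the
   maximization. *)
pose sol t := [set u | 0 <= u <= 1 /\ solves_FOC T R eta D Z theta_r t u].
pose uhat t := xget 0 (sol t).
have uhatP t : t \in `[0, T] -> ~ A0 T R eta Z theta_r t -> sol t (uhat t).
  by move=> tT /(FOC_exists t tT)[u uP]; apply: xgetPex; exists u.
have Psi_moment t y u : t \in `[0, T] -> u \in `[0, 1] ->
    Psi T R eta D Z lambda q t y u =
    lambda t y * (moment 0%N 0 - moment 0%N (c t * (1 - u)) - c t * k * u).
  move=> tT u01; rewrite (PsiE _ _ _ (ltW heta) u01 (fin t tT)) q_evp// EZ/=.
  by rewrite /k /moment /c; ring.
(* With [s = c t * (1 - u)] and [s' = c t * (1 - v)], one has [s' - s = c t * (u - v)]; the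
   hypothesis is thus the sign condition for [s], divided by [- c t]. *)
have argmax t y u : t \in `[0, T] -> u \in `[0, 1] ->
    (forall v, v \in `[0, 1] ->
      0 <= (v - u) * (k - moment 1%N (c t * (1 - u)))) ->
    unique (is_argmax_on (Psi T R eta D Z lambda q t y) `[0, 1]) u.
  move=> tT u01 opt.
  have lt_Psi v : v \in `[0, 1] -> v != u ->
      Psi T R eta D Z lambda q t y v < Psi T R eta D Z lambda q t y u.
    move=> v01 vu.
    have sc w : w \in `[0, 1] -> c t * (1 - w) <= c t.
      by rewrite in_itv/= => /andP[w0 _]; rewrite ler_piMr ?gerBl// ltW.
    have tangent :=
      exp_moment0_tangent mU PU mZ Z0 (fin t tT) (sc u u01) (sc v v01).
    have {}tangent : moment 0%N (c t * (1 - u)) +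
        c t * (u - v) * moment 1%N (c t * (1 - u)) < moment 0%N (c t * (1 - v)).
      rewrite (_ : c t * (u - v) = c t * (1 - v) - c t * (1 - u)); last by ring.
      apply: tangent; apply: contra vu => /eqP /mulfI.
      by rewrite gt_eqF// => /(_ isT) /subrI ->.
    rewrite !Psi_moment// ltr_pM2l ?lambda_gt0//.
    (* Scaled by [c t], the sign condition adds linearly to the tangent inequality. *)
    have := opt v v01; rewrite -(pmulr_rge0 _ (c_gt0 t)); lra.
  split.
    split=> [|v v01]; first exact: u01.
    by have [->//|/(lt_Psi v v01)/ltW] := eqVneq v u.
  move=> v [v01 /(_ u u01)]; have [//|vu] := eqVneq v u.
  by rewrite leNgt lt_Psi.
exists (fun t => if `[< A0 T R eta Z theta_r t >] then 0 else uhat t), uhat.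
split=> [t y tT|]; last split=> [t tT nA0|]; last split=> t.
- case: asboolP => [/(A0E t tT) ck|/(uhatP t tT)[u01 /FOCE uk]];
    apply: argmax => //.
  + by rewrite in_itv/= lexx ler01.
  (* At [u = 0] both factors are nonnegative: [v >= 0], and membership in [A0] means
     [moment 1 (c t) <= k]. *)
  + move=> v; rewrite in_itv/= => /andP[v0 _].
    by rewrite !subr0 mulr1 mulr_ge0// subr_ge0.
  (* At the root of the first-order condition the second factor vanishes. *)
  + by move=> v _; rewrite /moment /exp_moment /Rintegral uk subrr mulr0.
- have [_ uk] := uhatP t tT nA0; split=> // v; exact: FOC_unique.
- by move=> A0t; rewrite asboolT.
- by move=> tT nA0t; rewrite asboolF.
Qed.
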